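(* Let $\mathcal C$ be a non-empty class of Banach lattices such that $\overline{\mathcal C}$ is closed under lattice quotients (quotients by closed ideals). Let $X_0,X_1,X_2\in\overline{\mathcal C}$ and let $T_i:X_0\to X_i$ ($i=1,2$) be bounded lattice homomorphisms. Then there exist $PO\in\overline{\mathcal C}$ and lattice homomorphisms $S_i:X_i\to PO$ ($i=1,2$) with $\max\{\|S_1\|,\|S_2\|\}\le1$ and $S_1T_1=S_2T_2$, such that for every $Z\in\overline{\mathcal C}$ and lattice homomorphisms $R_i:X_i\to Z$ with $R_1T_1=R_2T_2$ there is a unique lattice homomorphism $\gamma:PO\to Z$ with $\gamma S_i=R_i$ ($i=1,2$), and moreover $\|\gamma\|\le\max\{\|R_1\|,\|R_2\|\}$.
   Context: $\overline{\mathcal C}$ is the class of Banach lattices lattice isometric to a closed sublattice of some $(\bigoplus_{\gamma\in\Gamma}X_\gamma)_\infty$ with all $X_\gamma\in\mathcal C$ (repetitions allowed). *)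

(* Defs.v *)
From HB Require Import structures.
From mathcomp Require Import all_boot all_order all_algebra.
From mathcomp Require Import all_classical all_reals all_analysis.
Set Implicit Arguments. Unset Strict Implicit. Unset Printing Implicit Defensive.
Import Order.TTheory GRing.Theory Num.Theory.
Import numFieldNormedType.Exports.
Local Open Scope ring_scope.

Record BanachLattice (R : realType) := {
  BL_sort :> completeNormedModType R;
  BL_le : BL_sort -> BL_sort -> Prop;
  BL_join : BL_sort -> BL_sort -> BL_sort;
  BL_le_refl : forall x, BL_le x x;
  BL_le_anti : forall x y, BL_le x y -> BL_le y x -> x = y;
  BL_le_trans : forall x y z, BL_le x y -> BL_le y z -> BL_le x z;
  BL_le_add : forall x y z, BL_le x y -> BL_le (x + z) (y + z);
  BL_le_scale : forall (a : R) x y, 0 <= a -> BL_le x y -> BL_le (a *: x) (a *: y);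
  BL_join_ubl : forall x y, BL_le x (BL_join x y);
  BL_join_ubr : forall x y, BL_le y (BL_join x y);
  BL_join_least : forall x y z, BL_le x z -> BL_le y z -> BL_le (BL_join x y) z;
  BL_lattice_norm : forall x y,
    BL_le (BL_join x (- x)) (BL_join y (- y)) -> `|x| <= `|y|
}.

Definition is_linear (R : realType) (X Y : BanachLattice R) (f : X -> Y) :=
  forall (a : R) (x y : X), f (a *: x + y) = a *: f x + f y.

(* lattice homomorphisms: linear maps preserving finite suprema
   (hence also infima); they are automatically bounded *)
Definition lattice_hom (R : realType) (X Y : BanachLattice R) (f : X -> Y) :=
  is_linear f /\ forall x y : X, f (BL_join x y) = BL_join (f x) (f y).

Definition bounded_op (R : realType) (X Y : BanachLattice R) (f : X -> Y) :=
  exists C : R, forall x : X, `|f x| <= C * `|x|.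

Definition opnorm_le (R : realType) (X Y : BanachLattice R) (f : X -> Y) (c : R) :=
  forall x : X, `|f x| <= c * `|x|.

Definition BLclass (R : realType) := BanachLattice R -> Prop.

(* X is lattice isometric to a (necessarily closed) sublattice of the
   l_infty-sum (\bigoplus_{g in G} F g)_infty, all F g in C (repetitions allowed).
   J : X -> forall g, F g is linear, preserves joins (coordinatewise lattice
   operations of the l_infty-sum), takes values in bounded families, and
   ||x|| = sup_g ||J x g|| (the l_infty norm, 0 for empty G). *)
Definition closure_class (R : realType) (C : BLclass R) : BLclass R :=
  fun X => exists (G : Type) (F : G -> BanachLattice R)
                  (J : X -> forall g : G, F g),
    (forall g, C (F g)) /\
    (forall (a : R) (x y : X) (g : G), J (a *: x + y) g = a *: J x g + J y g) /\
    (forall (x y : X) (g : G), J (BL_join x y) g = BL_join (J x g) (J y g)) /\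
    (forall (x : X) (g : G), `|J x g| <= `|x|) /\
    (forall (x : X) (c : R), 0 <= c -> (forall g, `|J x g| <= c) -> `|x| <= c).

(* Q : X -> Y is a lattice quotient map: a surjective lattice homomorphism such
   that ||y|| = inf { ||x|| : Q x = y }.  Then Y is lattice isometric to
   X / ker Q with ker Q a closed ideal, and every X / I arises this way. *)
Definition lattice_quotient_map (R : realType) (X Y : BanachLattice R) (Q : X -> Y) :=
  lattice_hom Q /\
  (forall x : X, `|Q x| <= `|x|) /\
  (forall (y : Y) (e : R), 0 < e -> exists x : X, Q x = y /\ `|x| < `|y| + e).

Definition closed_under_quotients (R : realType) (D : BLclass R) :=
  forall (X Y : BanachLattice R) (Q : X -> Y),
    D X -> lattice_quotient_map Q -> D Y.

(* Main.v *)
(** Banach lattices in the closure of C can be presented by generators and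
    relations. Fix generators i with weights w i >= 0 and relations between
    formal lattice-linear terms in them, and call model a family (f i) in a
    member of C that satisfies the relations and |f i| <= w i. Mapping each
    generator to the family of its values in all models (a set of them that
    witnesses the norms of all terms suffices) lands in an l_infty-sum of
    members of C, and the presented Banach lattice is the closed sublattice
    generated there. If Z is in the class and f satisfies the relations in Z
    with |f i| <= c * w i, then composing f with the coordinates of Z and
    dividing by c gives models, whence |f t| <= c * |t| for every term t, and
    f extends by continuity. The extension is unique because lattice
    homomorphisms between Banach lattices are automatically bounded. The
    pushout has the elements of X1 and X2 as generators, their norms as
    weights, and the relations expressing that the two inclusions are lattice
    homomorphisms and agree along T1 and T2. *)

Require Import Defs.
From HB Require Import structures.
From mathcomp Require Import all_boot all_order all_algebra.
From mathcomp Require Import all_classical all_reals all_analysis.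
From mathcomp Require Import lra.
Set Implicit Arguments.
Unset Strict Implicit.
Unset Printing Implicit Defensive.
Import Order.TTheory GRing.Theory Num.Theory.
Import numFieldNormedType.Exports.
Local Open Scope classical_set_scope.
Local Open Scope ring_scope.

(** * Dense families in normed spaces *)

Lemma cauchy_normP (R : realType) (V : normedModType R) (F : set_system V) :
  ProperFilter F ->
  cauchy F <->
  forall e : R, 0 < e -> exists x, \forall y \near F, `|x - y| <= e.
Proof.
move=> PF; split=> [/cauchyP cF e e0|near_dist].
  have [x Fx] := cF _ e0; exists x; apply: filterS Fx => y.
  by rewrite -ball_normE => /ltW.
apply: cauchy_exP => e e0; have [x Fx] := near_dist _ (divr_gt0 e0 (ltr0n _ 2)).
exists x; apply: filterS Fx => y xy; rewrite -ball_normE/=; lra.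
Qed.

Lemma closure_cvgnP (R : realType) (V : normedModType R) (A : set V) (x : V) :
  closure A x <-> exists2 a : nat -> V, (forall n, A (a n)) & a @ \oo --> x.
Proof.
split=> [clAx|[a Aa ax]]; last first.
  apply: (closed_cvg (closure A)) ax; first exact: closed_closure.
  by apply: nearW => n; exact: subset_closure.
have near_x n : exists y, A y /\ `|x - y| < n.+1%:R^-1.
  have n1_gt0 : 0 < n.+1%:R^-1 :> R by [].
  have [y [Ay xy]] := clAx _ (nbhsx_ballx x _ n1_gt0).
  by exists y; split=> //; move: xy; rewrite -ball_normE.
have [a /all_and2[Aa xa]] := choice near_x.
exists a => //; apply/cvgrPdist_lt => e e0.
have [N _ inv_lt_e] := cvgr_lt _ (@cvg_harmonic R) _ e0.
by exists N => // n /= Nn; exact: lt_trans (xa n) (inv_lt_e _ Nn).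
Qed.

Lemma closure_range_cvgn (R : realType) (T : Type) (V : normedModType R)
    (u : T -> V) (x : V) :
  closure (range u) x -> exists s : nat -> T, u \o s @ \oo --> x.
Proof.
move=> /closure_cvgnP[a range_a ax].
have preimage n : exists t, u t = a n by have [t _ <-] := range_a n; exists t.
have [s us] := choice preimage.
by exists s; rewrite (_ : u \o s = a)//; exact/funext.
Qed.

Lemma lipschitz_dense_extension (R : realType) (T : Type) (V : normedModType R)
    (W : completeNormedModType R) (u : T -> V) (v : T -> W) (k : R) :
  (forall x, closure (range u) x) ->
  (forall s t, `|v s - v t| <= k * `|u s - u t|) ->
  exists g : V -> W, forall (x : V) (s : nat -> T),
    u \o s @ \oo --> x -> v \o s @ \oo --> g x.
Proof.
move=> dense_u lip.
have cvg_image (x : V) (s : nat -> T) : u \o s @ \oo --> x -> cvgn (v \o s).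
  move=> sx; apply: cauchy_cvg; apply/cauchy_ballP => e e0.
  have k1_gt0 : 0 < `|k| + 1 by rewrite ltr_wpDl.
  have /cvg_cauchy/cauchy_ballP cauchy_us := cvgP x sx.
  move: (cauchy_us _ (divr_gt0 e0 k1_gt0)); rewrite !near_simpl -!ball_normE/=.
  apply: filterS => -[m n] /=.
  rewrite ltr_pdivlMr// => near_mn.
  apply: le_lt_trans near_mn; apply: le_trans (lip _ _) _; rewrite mulrC.
  by rewrite ler_wpM2l// (le_trans (ler_norm k))// lerDl.
have [s su] := choice (fun x : V => closure_range_cvgn (dense_u x)).
exists (fun x => limn (v \o s x)) => x t tx.
have dist0 : (fun n => v (s x n) - v (t n)) @ \oo --> (0 : W).
  apply/norm_cvg0P.
  have bound0 : (fun n => k * `|u (s x n) - u (t n)|) @ \oo --> (0 : R).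
    have -> : 0 = k * `|x - x| by rewrite subrr normr0 mulr0.
    by apply: cvgM; [exact: cvg_cst|apply: cvg_norm; exact: cvgB (su x) tx].
  apply: (squeeze_cvgr _ (cvg_cst 0) bound0).
  by apply: nearW => n; rewrite normr_ge0 lip.
rewrite (_ : v \o t = (fun n => v (s x n) - (v (s x n) - v (t n)))).
  by rewrite -[X in _ --> X]subr0; exact: cvgB (cvg_image _ _ (su x)) dist0.
by apply/funext => n /=; rewrite subKr.
Qed.

(** * Riesz space inequalities *)

Section BanachLatticeTheory.
Variables (R : realType) (X : BanachLattice R).
Implicit Types x y z t : X.

Definition BL_abs x := BL_join x (- x).

Lemma BL_leD x y z t : BL_le x y -> BL_le z t -> BL_le (x + z) (y + t).
Proof.
move=> xy zt; apply: BL_le_trans (BL_le_add z xy) _.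
by rewrite ![y + _]addrC; exact: BL_le_add.
Qed.

Lemma BL_subr_ge0 x y : BL_le 0 (y - x) <-> BL_le x y.
Proof.
split=> [/(BL_le_add x)|/(BL_le_add (- x))]; first by rewrite add0r subrK.
by rewrite subrr.
Qed.

Lemma BL_leBlDr x y z : BL_le (x - y) z <-> BL_le x (z + y).
Proof. by rewrite -BL_subr_ge0 -[BL_le x _]BL_subr_ge0 opprB addrA. Qed.

Lemma BL_leN x y : BL_le x y -> BL_le (- y) (- x).
Proof. by rewrite -BL_subr_ge0 -[BL_le (- y) _]BL_subr_ge0 opprK addrC. Qed.

Lemma BL_sum_ge0 (I : Type) (r : seq I) (P : pred I) (F : I -> X) :
  (forall i, BL_le 0 (F i)) -> BL_le 0 (\sum_(i <- r | P i) F i).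
Proof.
move=> F0; elim/big_ind : _ => // [|x y x0 y0]; first exact: BL_le_refl.
by rewrite -[0]addr0; exact: BL_leD.
Qed.

Lemma BL_joinC x y : BL_join x y = BL_join y x.
Proof.
by apply: BL_le_anti; apply: BL_join_least;
  (exact: BL_join_ubl || exact: BL_join_ubr).
Qed.

Lemma BL_join_l x y : BL_le y x -> BL_join x y = x.
Proof.
move=> yx; apply: BL_le_anti; last exact: BL_join_ubl.
by apply: BL_join_least => //; exact: BL_le_refl.
Qed.

Lemma BL_joinxx x : BL_join x x = x.
Proof. exact/BL_join_l/BL_le_refl. Qed.

Lemma BL_le_scale_join (a : R) x y :
  0 <= a -> BL_le (BL_join (a *: x) (a *: y)) (a *: BL_join x y).
Proof.
move=> a0; apply: BL_join_least; apply: BL_le_scale a0 _.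
  exact: BL_join_ubl.
exact: BL_join_ubr.
Qed.

Lemma BL_scale_join (a : R) x y :
  0 < a -> a *: BL_join x y = BL_join (a *: x) (a *: y).
Proof.
move=> a0; apply: BL_le_anti; last exact: BL_le_scale_join (ltW a0).
have ainv_ge0 : 0 <= a^-1 by rewrite invr_ge0 ltW.
have := BL_le_scale (ltW a0) (BL_le_scale_join (a *: x) (a *: y) ainv_ge0).
by rewrite !scalerA mulfV ?gt_eqF// mulVf ?gt_eqF// !scale1r.
Qed.

Lemma BL_le_abs x : BL_le x (BL_abs x).
Proof. exact: BL_join_ubl. Qed.

Lemma BL_leN_abs x : BL_le (- x) (BL_abs x).
Proof. exact: BL_join_ubr. Qed.

Lemma BL_absN x : BL_abs (- x) = BL_abs x.
Proof. by rewrite /BL_abs opprK BL_joinC. Qed.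

Lemma BL_abs_ge0 x : BL_le 0 (BL_abs x).
Proof.
have := BL_leD (BL_le_abs x) (BL_leN_abs x); rewrite subrr -mulr2n => le0.
have half_ge0 : 0 <= 2^-1 :> R by rewrite invr_ge0.
have := BL_le_scale half_ge0 le0.
by rewrite scaler0 -[BL_abs x *+ 2]scaler_nat scalerA mulVf// scale1r.
Qed.

Lemma BL_ge0_abs x : BL_le 0 x -> BL_abs x = x.
Proof.
move=> x0; apply: BL_join_l; apply: (BL_le_trans _ x0).
by rewrite -oppr0; exact: BL_leN.
Qed.

Lemma BL_ler_norm x y : BL_le 0 x -> BL_le x y -> `|x| <= `|y|.
Proof.
move=> x0 xy; apply: BL_lattice_norm.
by rewrite -/(BL_abs x) -/(BL_abs y) !BL_ge0_abs//; exact: BL_le_trans xy.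
Qed.

Lemma BL_norm_abs x : `|BL_abs x| = `|x|.
Proof.
have abs_id : BL_abs (BL_abs x) = BL_abs x by exact/BL_ge0_abs/BL_abs_ge0.
by apply/eqP; rewrite eq_le; apply/andP; split; apply: BL_lattice_norm;
  rewrite -!/(BL_abs _) abs_id; exact: BL_le_refl.
Qed.

Lemma BL_join_le_add_abs x y z :
  BL_le (BL_join x z) (BL_join y z + BL_abs (x - y)).
Proof.
apply: BL_join_least.
  rewrite -[x in BL_le x](subrK y) addrC.
  exact: BL_leD (BL_join_ubl _ _) (BL_le_abs _).
rewrite -[z in BL_le z]addr0.
exact: BL_leD (BL_join_ubr _ _) (BL_abs_ge0 _).
Qed.

Lemma BL_joinl_dist x y z : `|BL_join x z - BL_join y z| <= `|x - y|.
Proof.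
apply: BL_lattice_norm; rewrite -/(BL_abs (x - y)); apply: BL_join_least.
  by apply/BL_leBlDr; rewrite addrC; exact: BL_join_le_add_abs.
rewrite opprB -BL_absN opprB; apply/BL_leBlDr; rewrite addrC.
exact: BL_join_le_add_abs.
Qed.

Lemma BL_join_dist x y z t :
  `|BL_join x z - BL_join y t| <= `|x - y| + `|z - t|.
Proof.
apply: le_trans (ler_distD (BL_join y z) _ _) _; apply: lerD.
  exact: BL_joinl_dist.
by rewrite ![BL_join y _]BL_joinC; exact: BL_joinl_dist.
Qed.

Lemma cvg_BL_join (I : Type) (F : set_system I) (FF : Filter F)
    (f g : I -> X) x y :
  f @ F --> x -> g @ F --> y ->
  (fun i => BL_join (f i) (g i)) @ F --> BL_join x y.
Proof.
move=> fx gy; apply/cvgrPdist_lt => e e0; near=> i.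
apply: le_lt_trans (BL_join_dist _ _ _ _) _; rewrite [e]splitr ltrD//.
  by near: i; apply: cvgr_dist_lt fx _ (divr_gt0 e0 _).
by near: i; apply: cvgr_dist_lt gy _ (divr_gt0 e0 _).
Unshelve. all: by end_near. Qed.

Lemma BL_le_cvg (I : Type) (F : set_system I) (FF : ProperFilter F)
    (f : I -> X) x y :
  f @ F --> y -> (\forall i \near F, BL_le x (f i)) -> BL_le x y.
Proof.
move=> fy le_xf; rewrite -[y](_ : BL_join y x = y); first exact: BL_join_ubr.
apply: (cvg_unique (@norm_hausdorff _ X) _ fy).
apply: cvg_trans (cvg_BL_join FF fy (cvg_cst x)).
by apply: near_eq_cvg; apply: filterS le_xf => i /BL_join_l.
Qed.

Lemma BL_le_lim_series (y : nat -> X) n :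
  (forall i, BL_le 0 (y i)) -> cvgn (series y) -> BL_le (y n) (limn (series y)).
Proof.
move=> y0 cvg_y; apply: (BL_le_cvg _ cvg_y); exists n.+1 => // m /= nm.
rewrite /series/= (bigD1_seq n) ?iota_uniq ?mem_index_iota//=.
rewrite -[X in BL_le X]addr0; apply: BL_leD (BL_le_refl _) _.
exact: BL_sum_ge0.
Qed.

End BanachLatticeTheory.

(** * Automatic boundedness *)

Section PositiveOperators.
Variables (R : realType) (X Y : BanachLattice R) (T : X -> Y).
Hypotheses (linT : is_linear T) (T_ge0 : forall x, BL_le 0 x -> BL_le 0 (T x)).

#[local] HB.instance Definition _ := GRing.isLinear.Build R X Y _ T linT.

Lemma positive_linear_le x y : BL_le x y -> BL_le (T x) (T y).
Proof. by rewrite -BL_subr_ge0 => /T_ge0; rewrite linearB BL_subr_ge0. Qed.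

Lemma positive_linear_norm_abs x : `|T x| <= `|T (BL_abs x)|.
Proof.
apply: BL_lattice_norm; rewrite -!/(BL_abs _).
rewrite (BL_ge0_abs (T_ge0 (BL_abs_ge0 x))); apply: BL_join_least.
  exact/positive_linear_le/BL_le_abs.
by rewrite -linearN; exact/positive_linear_le/BL_leN_abs.
Qed.

Lemma unbounded_positive_witness (K : R) : 0 <= K -> ~ bounded_op T ->
  exists y, [/\ BL_le 0 y, `|y| = 1 & K < `|T y|].
Proof.
move=> K0 unbounded.
have [x Kx] : exists x, K * `|x| < `|T x|.
  apply: contrapT => bounded; apply: unbounded; exists K => x.
  by rewrite leNgt; apply/negP => Kx; apply: bounded; exists x.
have x0 : 0 < `|x|.
  rewrite normr_gt0; apply: contraTneq Kx => ->.
  by rewrite linear0 !normr0 mulr0 ltxx.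
exists (`|x|^-1 *: BL_abs x); split.
- rewrite -(scaler0 _ `|x|^-1).
  by apply: BL_le_scale (BL_abs_ge0 x); rewrite invr_ge0.
- by rewrite normrZ BL_norm_abs ger0_norm ?invr_ge0// mulVf// gt_eqF.
- rewrite linearZ normrZ ger0_norm ?invr_ge0// mulrC ltr_pdivlMr//.
  exact: lt_le_trans Kx (positive_linear_norm_abs x).
Qed.

(* If T is unbounded, take y_n >= 0 of norm 1 with |T y_n| > n 2^n. The sum s of
   the y_n / 2^n dominates each of its terms, hence |T s| > n for all n. *)
Lemma positive_linear_bounded : bounded_op T.
Proof.
apply: contrapT => unbounded.
have K_ge0 n : 0 <= n%:R * 2 ^+ n :> R by rewrite mulr_ge0// exprn_ge0.
have [y y_spec] :=
  choice (fun n : nat => unbounded_positive_witness (K_ge0 n) unbounded).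
pose a n : X := 2^-1 ^+ n *: y n.
have half_ge0 n : 0 <= 2^-1 ^+ n :> R by rewrite exprn_ge0// invr_ge0.
have a_ge0 n : BL_le 0 (a n).
  have [y0 _ _] := y_spec n; rewrite -(scaler0 _ (2^-1 ^+ n)).
  exact: BL_le_scale.
have norm_Ta n : n%:R < `|T (a n)|.
  have [_ _ Ty] := y_spec n; rewrite linearZ normrZ ger0_norm// exprVn mulrC.
  by rewrite ltr_pdivlMr ?exprn_gt0.
have cvg_a : cvgn (series a).
  apply: normed_cvg; rewrite /normed_series_of.
  rewrite (_ : (fun n => `|a n|) = geometric 1 2^-1).
    apply: is_cvg_geometric_series.
    by rewrite ger0_norm ?invr_ge0// invf_lt1// ltr1n.
  apply/funext => n; have [_ y1 _] := y_spec n.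
  by rewrite /a normrZ y1 mulr1 ger0_norm//= mul1r.
pose s := limn (series a); pose n := Num.bound `|T s|.
have lt_n : `|T s| < n%:R by exact: archi_boundP.
suff : `|T (a n)| <= `|T s| by rewrite leNgt (lt_trans lt_n).
apply: BL_ler_norm; first exact: T_ge0.
exact/positive_linear_le/BL_le_lim_series.
Qed.

End PositiveOperators.

Lemma bounded_op_continuous (R : realType) (X Y : BanachLattice R)
    (T : X -> Y) :
  is_linear T -> bounded_op T -> continuous T.
Proof.
move=> linT [c Tc].
pose L : {linear X -> Y} := HB.pack T (GRing.isLinear.Build R X Y _ T linT).
apply: (@bounded_linear_continuous _ _ _ L); apply/linear_boundedP.
apply: filterS (nbhs_pinfty_ge (num_real c)) => r cr x.
by apply: le_trans (Tc x) _; rewrite ler_wpM2r.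
Qed.

Section LatticeHom.
Variables (R : realType) (X Y : BanachLattice R) (T : X -> Y).
Hypothesis homT : lattice_hom T.

Lemma lattice_homP (a : R) x y : T (a *: x + y) = a *: T x + T y.
Proof. by case: homT => linT _; exact: linT. Qed.

Lemma lattice_hom_join x y : T (BL_join x y) = BL_join (T x) (T y).
Proof. by case: homT. Qed.

Lemma lattice_hom0 : T 0 = 0.
Proof.
by have := lattice_homP (-1) 0 0; rewrite scaler0 addr0 scaleN1r addNr.
Qed.

Lemma lattice_hom_ge0 x : BL_le 0 x -> BL_le 0 (T x).
Proof.
move=> x0; rewrite -(BL_join_l x0) lattice_hom_join lattice_hom0.
exact: BL_join_ubr.
Qed.

Lemma lattice_hom_bounded : bounded_op T.
Proof. exact: positive_linear_bounded homT.1 lattice_hom_ge0. Qed.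

Lemma lattice_hom_continuous : continuous T.
Proof. exact: bounded_op_continuous homT.1 lattice_hom_bounded. Qed.

End LatticeHom.

Lemma lattice_hom_comp (R : realType) (X Y Z : BanachLattice R)
    (S : Y -> Z) (T : X -> Y) :
  lattice_hom S -> lattice_hom T -> lattice_hom (S \o T).
Proof.
move=> homS homT; split=> [a x y|x y] /=; first by rewrite !lattice_homP.
by rewrite !lattice_hom_join.
Qed.

Lemma lattice_hom_scale (R : realType) (X : BanachLattice R) (a : R) :
  0 < a -> lattice_hom (fun x : X => a *: x).
Proof.
move=> a0; split=> [b x y|x y]; last exact: BL_scale_join.
by rewrite scalerDr !scalerA mulrC.
Qed.

Lemma lattice_hom_eq_dense (R : realType) (T : Type) (X Y : BanachLattice R)
    (u : T -> X) (g h : X -> Y) :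
  (forall x, closure (range u) x) -> lattice_hom g -> lattice_hom h ->
  g \o u = h \o u -> g = h.
Proof.
move=> dense_u homg homh gh; apply/funext => x.
have [s sx] := closure_range_cvgn (dense_u x).
have gs : (g \o u) \o s @ \oo --> g x.
  by apply: (continuous_cvg _ _ sx); exact: lattice_hom_continuous.
apply: (cvg_unique (@norm_hausdorff _ Y) gs); rewrite gh.
by apply: (continuous_cvg _ _ sx); exact: lattice_hom_continuous.
Qed.

(** * The l_infty-sum of a family *)

Section LinfModule.
Variables (R : realType) (G : Type) (F : G -> normedModType R).

Definition bounded_family (f : forall g, F g) :=
  exists M : R, forall g, `|f g| <= M.

Definition linf : Type := {f : forall g, F g | bounded_family f}.

Definition linf_coord (f : linf) : forall g, F g := sval f.
Coercion linf_coord : linf >-> Funclass.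

Implicit Types f h k : linf.

HB.instance Definition _ := gen_eqMixin linf.
HB.instance Definition _ := gen_choiceMixin linf.

Lemma linf_ext f h : (forall g, f g = h g) -> f = h.
Proof.
case: f h => [f bf] [h bh] /= fh.
have {}fh : f = h by exact: functional_extensionality_dep.
by subst h; congr exist; exact: Prop_irrelevance.
Qed.

Lemma bounded_family0 : bounded_family (fun g => 0).
Proof. by exists 0 => g; rewrite normr0. Qed.

Lemma bounded_familyN f : bounded_family (fun g => - f g).
Proof. by have [M fM] := svalP f; exists M => g; rewrite normrN. Qed.

Lemma bounded_familyD f h : bounded_family (fun g => f g + h g).
Proof.
have [[M fM] [N hN]] := (svalP f, svalP h); exists (M + N) => g.
by apply: le_trans (ler_normD _ _) _; exact: lerD.
Qed.

Lemma bounded_familyZ (a : R) f : bounded_family (fun g => a *: f g).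
Proof.
have [M fM] := svalP f; exists (`|a| * M) => g.
by rewrite normrZ ler_wpM2l// fM.
Qed.

Definition linf_zero : linf := exist _ _ bounded_family0.
Definition linf_opp f : linf := exist _ _ (bounded_familyN f).
Definition linf_add f h : linf := exist _ _ (bounded_familyD f h).
Definition linf_scale (a : R) f : linf := exist _ _ (bounded_familyZ a f).

Fact linf_addA : associative linf_add.
Proof. by move=> f h k; apply: linf_ext => g; exact: addrA. Qed.

Fact linf_addC : commutative linf_add.
Proof. by move=> f h; apply: linf_ext => g; exact: addrC. Qed.

Fact linf_add0 : left_id linf_zero linf_add.
Proof. by move=> f; apply: linf_ext => g; exact: add0r. Qed.

Fact linf_addN : left_inverse linf_zero linf_opp linf_add.
Proof. by move=> f; apply: linf_ext => g; exact: addNr. Qed.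

HB.instance Definition _ :=
  GRing.isZmodule.Build linf linf_addA linf_addC linf_add0 linf_addN.

Fact linf_scaleA (a b : R) f :
  linf_scale a (linf_scale b f) = linf_scale (a * b) f.
Proof. by apply: linf_ext => g; exact: scalerA. Qed.

Fact linf_scale1 : left_id 1 linf_scale.
Proof. by move=> f; apply: linf_ext => g; exact: scale1r. Qed.

Fact linf_scaleDr : right_distributive linf_scale +%R.
Proof. by move=> a f h; apply: linf_ext => g; exact: scalerDr. Qed.

Fact linf_scaleDl f : {morph linf_scale^~ f : a b / a + b}.
Proof. by move=> a b; apply: linf_ext => g; exact: scalerDl. Qed.

HB.instance Definition _ := GRing.Zmodule_isLmodule.Build R linf
  linf_scaleA linf_scale1 linf_scaleDr linf_scaleDl.

(* 0 is added to the set of coordinate norms so that the supremum is 0, not a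
   junk value, when G is empty. *)
Definition linf_norm f : R := sup (0 |` range (fun g => `|f g|)).

Lemma linf_norm_has_sup f : has_sup (0 |` range (fun g => `|f g|)).
Proof.
split; first by exists 0; left.
have [M fM] := svalP f.
exists (Num.max 0 M) => _ [->|[g _ <-]]; first by rewrite le_max lexx.
by rewrite le_max fM orbT.
Qed.

Lemma linf_norm_coord f g : `|f g| <= linf_norm f.
Proof.
by apply: sup_upper_bound; [exact: linf_norm_has_sup|right; exists g].
Qed.

Lemma linf_norm_ge0 f : 0 <= linf_norm f.
Proof. by apply: sup_upper_bound; [exact: linf_norm_has_sup|left]. Qed.

Lemma linf_norm_le f (c : R) :
  0 <= c -> (forall g, `|f g| <= c) -> linf_norm f <= c.
Proof.
move=> c0 fc; apply: ge_sup; first by exists 0; left.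
by move=> _ [->|[g _ <-]].
Qed.

Lemma linf_normD f h : linf_norm (f + h) <= linf_norm f + linf_norm h.
Proof.
apply: linf_norm_le => [|g]; first by rewrite addr_ge0// linf_norm_ge0.
by apply: le_trans (ler_normD _ _) _; apply: lerD; exact: linf_norm_coord.
Qed.

Lemma linf_normZ (a : R) f : linf_norm (a *: f) = `|a| * linf_norm f.
Proof.
have normZ_le b k : linf_norm (b *: k) <= `|b| * linf_norm k.
  apply: linf_norm_le => [|g]; first by rewrite mulr_ge0// linf_norm_ge0.
  by rewrite [linf_coord _ g]/(b *: k g) normrZ ler_wpM2l// linf_norm_coord.
apply/eqP; rewrite eq_le normZ_le/=.
have [->|a0] := eqVneq a 0; first by rewrite normr0 mul0r linf_norm_ge0.
have := normZ_le a^-1 (a *: f); rewrite scalerA mulVf// scale1r normfV.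
by rewrite ler_pdivlMl// normr_gt0.
Qed.

Lemma linf_norm0_eq0 f : linf_norm f = 0 -> f = 0.
Proof.
move=> f0; apply: linf_ext => g; apply/eqP; rewrite -normr_le0.
by have := linf_norm_coord f g; rewrite f0.
Qed.

HB.instance Definition _ := Lmodule_isNormed.Build R linf
  linf_normD linf_normZ linf_norm0_eq0.

End LinfModule.

Section LinfComplete.
Variables (R : realType) (G : Type) (F : G -> completeNormedModType R).
Local Notation L := (linf F).

Lemma linf_cauchy_coord (A : set_system L) : ProperFilter A -> cauchy A ->
  exists l : forall g, F g, forall (e : R) (k : L),
    (\forall f \near A, `|k - f| <= e) -> forall g, `|k g - l g| <= e.
Proof.
move=> PA cauchyA.
have cvg_coord g : cvg ((fun f : L => f g : F g) @ A).
  apply: cauchy_cvg; apply/cauchy_normP => e e0.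
  have [k near_k] := (cauchy_normP PA).1 cauchyA _ e0.
  exists (linf_coord k g); apply: filterS near_k => f; apply: le_trans.
  exact: (linf_norm_coord (k - f)).
pose l g : F g := lim ((fun f : L => f g : F g) @ A).
exists l => e k near_k g.
have : (fun f : L => `|k g - f g|) @ A --> `|k g - l g|.
  by apply: cvg_norm; apply: cvgB; [exact: cvg_cst|exact: cvg_coord].
move=> /cvgr_to_le; apply; apply: filterS near_k => f; apply: le_trans.
exact: (linf_norm_coord (k - f)).
Qed.

Lemma linf_complete (A : set_system L) : ProperFilter A -> cauchy A -> cvg A.
Proof.
move=> PA cauchyA; have [l l_close] := linf_cauchy_coord PA cauchyA.
have near_dist : forall e : R, 0 < e ->
    exists k : L, \forall f \near A, `|k - f| <= e.
  exact/cauchy_normP.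
have [k /l_close kl] := near_dist 1 ltr01.
have l_bounded : bounded_family l.
  exists (`|k| + 1) => g; rewrite -[l g](subKr (k g)).
  by apply: le_trans (ler_normB _ _) (lerD _ (kl g)); exact: linf_norm_coord.
apply/cvg_ex; exists (exist _ l l_bounded : L).
apply/(@cvgrPdist_le _ _ _ A _ id) => e e0.
have half_e_gt0 : 0 < e / 2 by rewrite divr_gt0.
have [h near_h] := near_dist _ half_e_gt0.
apply: filterS (near_h) => f hf; apply: le_trans (ler_distD h _ _) _.
rewrite [e]splitr; apply: lerD => //; rewrite distrC.
by apply: linf_norm_le => [|g]; [exact: ltW|exact: l_close near_h g].
Qed.

HB.instance Definition _ := Uniform_isComplete.Build L linf_complete.

End LinfComplete.

Section LinfBanachLattice.
Variables (R : realType) (G : Type) (F : G -> BanachLattice R).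
Local Notation L := (linf F).
Implicit Types f h k : L.

Lemma bounded_family_join f h : bounded_family (fun g => BL_join (f g) (h g)).
Proof.
exists (`|f| + `|h|) => g.
have := BL_join_dist (f g) 0 (h g) 0; rewrite BL_joinxx !subr0.
by move=> /le_trans; apply; apply: lerD; exact: linf_norm_coord.
Qed.

Definition linf_join f h : L := exist _ _ (bounded_family_join f h).

Definition linf_le f h := forall g, BL_le (f g) (h g).

Lemma linf_lattice_norm f h :
  linf_le (linf_join f (- f)) (linf_join h (- h)) -> `|f| <= `|h|.
Proof.
move=> fh; apply: linf_norm_le => [|g]; first exact: linf_norm_ge0.
by apply: le_trans (linf_norm_coord h g); apply: BL_lattice_norm; exact: fh.
Qed.

Program Definition linf_BanachLattice : BanachLattice R :=
  {| BL_sort := L : completeNormedModType R;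
     BL_le := linf_le; BL_join := linf_join;
     BL_lattice_norm := linf_lattice_norm |}.
Next Obligation. by move=> f g; exact: BL_le_refl. Qed.
Next Obligation.
by move=> f h fh hf; apply: linf_ext => g; exact: BL_le_anti.
Qed.
Next Obligation. by move=> f h k fh hk g; exact: BL_le_trans (hk g). Qed.
Next Obligation. by move=> f h k fh g; exact: BL_le_add. Qed.
Next Obligation. by move=> a f h a0 fh g; exact: BL_le_scale. Qed.
Next Obligation. by move=> f h g; exact: BL_join_ubl. Qed.
Next Obligation. by move=> f h g; exact: BL_join_ubr. Qed.
Next Obligation. by move=> f h k fk hk g; exact: BL_join_least. Qed.

Lemma linf_coord_hom g :
  @lattice_hom R linf_BanachLattice (F g) (fun f : L => f g).
Proof. by []. Qed.

Lemma closure_class_linf (C : BLclass R) :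
  (forall g, C (F g)) -> closure_class C linf_BanachLattice.
Proof.
move=> CF; exists G, F, (fun f : L => linf_coord f).
split=> //; do 2!split=> //.
by split; [exact: linf_norm_coord|exact: linf_norm_le].
Qed.

End LinfBanachLattice.

(** * Closed sublattices *)

Definition sublattice (R : realType) (X : BanachLattice R) (A : set X) :=
  [/\ A 0, forall (a : R) x y, A x -> A y -> A (a *: x + y) &
      forall x y, A x -> A y -> A (BL_join x y)].

Lemma closure_sublattice (R : realType) (X : BanachLattice R) (A : set X) :
  sublattice A -> sublattice (closure A).
Proof.
move=> [A0 A_lin A_join]; split; first exact: subset_closure.
  move=> a x y /closure_cvgnP[s As sx] /closure_cvgnP[t At ty].
  apply/closure_cvgnP; exists (fun n => a *: s n + t n) => [n|].
    exact: A_lin.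
  by apply: cvgD ty; apply: cvgZ sx; exact: cvg_cst.
move=> x y /closure_cvgnP[s As sx] /closure_cvgnP[t At ty].
apply/closure_cvgnP; exists (fun n => BL_join (s n) (t n)) => [n|].
  exact: A_join.
exact: cvg_BL_join.
Qed.

Record closed_sublattice (R : realType) (X : BanachLattice R) :=
  ClosedSublattice {
    csub_set :> X -> Prop;
    csub_sublattice : sublattice csub_set;
    csub_closed : closed csub_set }.

Section ClosedSublattice.
Variables (R : realType) (X : BanachLattice R) (A : closed_sublattice X).

Definition csub_pred : {pred X} := mem (A : set X).

Fact csub_submod_closed : submod_closed csub_pred.
Proof.
have [A0 A_lin _] := csub_sublattice A.
split=> [|a x y]; rewrite !inE; first exact: A0.
exact: A_lin.
Qed.

HB.instance Definition _ :=
  GRing.isSubmodClosed.Build R X csub_pred csub_submod_closed.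

Definition csub_type : Type := {x : X | x \in csub_pred}.

HB.instance Definition _ := SubChoice.copy csub_type {x : X | x \in csub_pred}.
HB.instance Definition _ := [SubChoice_isSubLmodule of csub_type by <:].

Definition csub_elt (z : X) (Az : A z) : csub_type :=
  exist (fun z : X => z \in csub_pred) z (mem_set Az).

Implicit Types x y z : csub_type.

Lemma csub_valP x : A (val x).
Proof. exact: set_mem (valP x). Qed.

Definition csub_norm x : R := `|val x|.

Fact csub_normD x y : csub_norm (x + y) <= csub_norm x + csub_norm y.
Proof. exact: ler_normD. Qed.

Fact csub_normZ (a : R) x : csub_norm (a *: x) = `|a| * csub_norm x.
Proof. exact: normrZ. Qed.

Fact csub_norm0_eq0 x : csub_norm x = 0 -> x = 0.
Proof. by move=> /normr0_eq0 x0; exact: val_inj. Qed.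

HB.instance Definition _ := Lmodule_isNormed.Build R csub_type
  csub_normD csub_normZ csub_norm0_eq0.

Fact csub_complete (F : set_system csub_type) :
  ProperFilter F -> cauchy F -> cvg F.
Proof.
move=> PF /cauchy_normP cauchyF.
have /cvg_ex[l Fl] : cvg ((val : csub_type -> X) @ F).
  apply: cauchy_cvg; apply/cauchy_normP => e /cauchyF[x near_x].
  by exists (val x).
have Al : A l.
  apply: (closed_cvg (A : set X)) Fl; first exact: csub_closed.
  by apply: nearW => x; exact: csub_valP.
apply/cvg_ex; exists (csub_elt Al).
apply/(@cvgrPdist_le _ _ _ F _ id) => e e0.
exact: cvgr_dist_le Fl _ e0.
Qed.

HB.instance Definition _ := Uniform_isComplete.Build csub_type csub_complete.

Fact csub_join_subproof x y : A (BL_join (val x) (val y)).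
Proof.
have [_ _ A_join] := csub_sublattice A.
by apply: A_join; exact: csub_valP.
Qed.

Definition csub_join x y := csub_elt (csub_join_subproof x y).

Program Definition csub_BanachLattice : BanachLattice R :=
  {| BL_sort := csub_type : completeNormedModType R;
     BL_le := fun x y => BL_le (val x) (val y); BL_join := csub_join |}.
Next Obligation. by move=> x; exact: BL_le_refl. Qed.
Next Obligation. by move=> x y xy yx; apply: val_inj; exact: BL_le_anti. Qed.
Next Obligation. by move=> x y z; exact: BL_le_trans. Qed.
Next Obligation. by move=> x y z; exact: BL_le_add. Qed.
Next Obligation. by move=> a x y; exact: BL_le_scale. Qed.
Next Obligation. by move=> x y; exact: BL_join_ubl. Qed.
Next Obligation. by move=> x y; exact: BL_join_ubr. Qed.
Next Obligation. by move=> x y z; exact: BL_join_least. Qed.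
Next Obligation. by move=> x y; exact: BL_lattice_norm. Qed.

Lemma csub_val_hom : @lattice_hom R csub_BanachLattice X val.
Proof. by []. Qed.

End ClosedSublattice.

(** * The classes [closure_class C] *)

Section ClosureClass.
Variables (R : realType) (C : BLclass R).

Lemma closure_class_isometry (X Y : BanachLattice R) (f : X -> Y) :
  closure_class C Y -> lattice_hom f -> (forall x, `|f x| = `|x|) ->
  closure_class C X.
Proof.
move=> [G [F [J [CF [J_lin [J_join [J_le J_norm]]]]]]] homf isof.
exists G, F, (J \o f); split=> //; split=> [a x y g|] /=.
  by rewrite (lattice_homP homf).
split=> [x y g|]; first by rewrite /= (lattice_hom_join homf).
split=> [x g|x c c0 Jc]; first by rewrite -isof; exact: J_le.
by rewrite -isof; exact: J_norm.
Qed.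

Lemma closure_class_norm_le (Z : BanachLattice R) (z : Z) (b : R) :
  closure_class C Z -> 0 <= b ->
  (forall (H : BanachLattice R) (h : Z -> H),
     C H -> lattice_hom h -> (forall x, `|h x| <= `|x|) -> `|h z| <= b) ->
  `|z| <= b.
Proof.
move=> [G [F [J [CF [J_lin [J_join [J_le J_norm]]]]]]] b0 bound.
apply: J_norm => // g; apply: (bound _ (fun x => J x g)) => //.
by split=> [a x y|x y].
Qed.

End ClosureClass.

(** * Banach lattices given by generators and relations *)

Inductive lattice_term (R : realType) (I : Type) : Type :=
  | Zero
  | Var of I
  | Lin of R & lattice_term R I & lattice_term R I
  | Join of lattice_term R I & lattice_term R I.
Arguments Zero {R I}.
Arguments Var {R I}.

Definition term_relation (R : realType) (I : Type) : Type :=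
  lattice_term R I -> lattice_term R I -> Prop.

Section LatticeTerms.
Variables (R : realType) (I : Type).
Implicit Types (s t : lattice_term R I) (E : term_relation R I).

Fixpoint term_eval (Z : BanachLattice R) (f : I -> Z) t : Z :=
  match t with
  | Zero => 0
  | Var i => f i
  | Lin a s t => a *: term_eval f s + term_eval f t
  | Join s t => BL_join (term_eval f s) (term_eval f t)
  end.

Definition satisfies E (Z : BanachLattice R) (f : I -> Z) :=
  forall s t, E s t -> term_eval f s = term_eval f t.

Lemma term_eval_comp (Y Z : BanachLattice R) (h : Y -> Z) (f : I -> Y) t :
  lattice_hom h -> term_eval (h \o f) t = h (term_eval f t).
Proof.
move=> homh; elim: t => //= [|a s -> t ->|s -> t ->].
- by rewrite lattice_hom0.
- by rewrite lattice_homP.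
- by rewrite lattice_hom_join.
Qed.

Lemma satisfies_comp E (Y Z : BanachLattice R) (h : Y -> Z) (f : I -> Y) :
  lattice_hom h -> satisfies E f -> satisfies E (h \o f).
Proof. by move=> homh Ef s t Est; rewrite !term_eval_comp// (Ef _ _ Est). Qed.

Lemma term_eval_eq0 (Z : BanachLattice R) (f : I -> Z) t :
  (forall i, f i = 0) -> term_eval f t = 0.
Proof.
move=> f0; elim: t => //= [a s -> t ->|s -> t ->].
  by rewrite scaler0 addr0.
exact: BL_joinxx.
Qed.

Lemma term_evalB (Z : BanachLattice R) (f : I -> Z) s t :
  term_eval f (Lin (-1) t s) = term_eval f s - term_eval f t.
Proof. by rewrite /= scaleN1r addrC. Qed.

Lemma sublattice_range_term_eval (Z : BanachLattice R) (f : I -> Z) :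
  sublattice (range (term_eval f)).
Proof.
split; first by exists Zero.
  by move=> a _ _ [s _ <-] [t _ <-]; exists (Lin a s t).
by move=> _ _ [s _ <-] [t _ <-]; exists (Join s t).
Qed.

Definition generates (Y : BanachLattice R) (f : I -> Y) :=
  forall y, closure (range (term_eval f)) y.

Lemma lattice_hom_eq_generators (Y Z : BanachLattice R) (f : I -> Y)
    (g h : Y -> Z) :
  generates f -> lattice_hom g -> lattice_hom h -> g \o f = h \o f -> g = h.
Proof.
move=> gen_f homg homh gh; apply: (lattice_hom_eq_dense gen_f) => //.
by apply/funext => t /=; rewrite -!term_eval_comp// gh.
Qed.

Lemma lattice_hom_extension (Y Z : BanachLattice R) (f : I -> Y) (g : I -> Z)
    (k : R) :
  generates f -> (forall t, `|term_eval g t| <= k * `|term_eval f t|) ->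
  exists gamma : Y -> Z, [/\ lattice_hom gamma, gamma \o f = g &
    forall c : R, (forall t, `|term_eval g t| <= c * `|term_eval f t|) ->
      opnorm_le gamma c].
Proof.
move=> gen_f bound.
have lip s t :
    `|term_eval g s - term_eval g t| <= k * `|term_eval f s - term_eval f t|.
  by rewrite -!term_evalB.
have [gamma gammaP] := lipschitz_dense_extension gen_f lip.
have approx y := closure_range_cvgn (gen_f y).
exists gamma; split.
- split=> [a x y|x y]; have [[s sx] [t ty]] := (approx x, approx y).
    have st : term_eval f \o (fun n => Lin a (s n) (t n)) @ \oo --> a *: x + y.
      by apply: cvgD ty; apply: cvgZ sx; exact: cvg_cst.
    apply: (cvg_unique (@norm_hausdorff _ Z) (gammaP _ _ st)).
    apply: cvgD (gammaP _ _ ty); apply: cvgZ (gammaP _ _ sx); exact: cvg_cst.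
  have st : term_eval f \o (fun n => Join (s n) (t n)) @ \oo --> BL_join x y.
    exact: cvg_BL_join sx ty.
  apply: (cvg_unique (@norm_hausdorff _ Z) (gammaP _ _ st)).
  exact: cvg_BL_join (gammaP _ _ sx) (gammaP _ _ ty).
- apply/funext => i /=.
  have fi : term_eval f \o (fun=> Var i) @ \oo --> f i by exact: cvg_cst.
  apply: (cvg_unique (@norm_hausdorff _ Z) (gammaP _ _ fi)); exact: cvg_cst.
- move=> c gc y; have [t ty] := approx y.
  apply: (ler_cvg_to (cvg_norm (gammaP _ _ ty))).
    by apply: cvgM (cvg_norm ty); exact: cvg_cst.
  by apply: nearW => n; exact: gc.
Qed.

End LatticeTerms.

Section Presentation.
Variables (R : realType) (C : BLclass R) (I : Type) (w : I -> R).
Variable E : term_relation R I.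
Implicit Types s t : lattice_term R I.

Record model := Model {
  model_space : BanachLattice R;
  model_map : I -> model_space;
  model_class : C model_space;
  model_satisfies : satisfies E model_map;
  model_norm_le : forall i, `|model_map i| <= w i }.
Arguments model_map : clear implicits.

(* The models form a proper class. One model for each strict inequality c < |t|
   that some model satisfies is enough to compute the supremum of the norms of
   each term t over that class. *)
Definition witnessed_bound : Type :=
  {p : lattice_term R I * R |
    exists m : model, p.2 < `|term_eval (model_map m) p.1|}.

Definition witness (p : witnessed_bound) : model := sval (cid (svalP p)).

Definition witness_space (p : witnessed_bound) := model_space (witness p).

Definition witness_sum := linf_BanachLattice witness_space.

Lemma bounded_family_witness i :
  bounded_family (fun p => model_map (witness p) i).
Proof. by exists (w i) => p; exact: model_norm_le. Qed.

Definition universal_family i : witness_sum :=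
  exist _ _ (bounded_family_witness i).

Lemma term_eval_universal_family t p :
  linf_coord (term_eval universal_family t) p =
  term_eval (model_map (witness p)) t.
Proof.
by rewrite -(term_eval_comp universal_family t (linf_coord_hom witness_space p)).
Qed.

Lemma term_eval_model_le (m : model) t :
  `|term_eval (model_map m) t| <= `|term_eval universal_family t|.
Proof.
rewrite leNgt; apply/negP => lt_m.
pose p : witnessed_bound :=
  exist _ (t, `|term_eval universal_family t|) (ex_intro _ m lt_m).
have := svalP (cid (svalP p)).
rewrite -/(witness p) -term_eval_universal_family ltNge => /negP; apply.
exact: linf_norm_coord.
Qed.

Definition presented_sublattice : closed_sublattice witness_sum :=
  ClosedSublattice
    (closure_sublattice (sublattice_range_term_eval universal_family))
    (@closed_closure _ _).

Definition presented := csub_BanachLattice presented_sublattice.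

Lemma presented_sublattice_gen i : presented_sublattice (universal_family i).
Proof. by apply: subset_closure; exists (Var i). Qed.

Definition presented_gen i : presented :=
  csub_elt (@presented_sublattice_gen i).

Lemma val_term_eval_presented t :
  val (term_eval presented_gen t) = term_eval universal_family t.
Proof.
by rewrite -(term_eval_comp presented_gen t (csub_val_hom presented_sublattice)).
Qed.

Lemma closure_class_presented : closure_class C presented.
Proof.
apply: (closure_class_isometry _ (csub_val_hom presented_sublattice)) => //.
by apply: closure_class_linf => p; exact: model_class.
Qed.

Lemma presented_gen_satisfies : satisfies E presented_gen.
Proof.
move=> s t Est; apply: val_inj; rewrite !val_term_eval_presented.
apply: linf_ext => p; rewrite !term_eval_universal_family.
exact: model_satisfies.
Qed.

Lemma presented_gen_norm i : 0 <= w i -> `|presented_gen i| <= w i.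
Proof. by move=> w0; apply: linf_norm_le => // p; exact: model_norm_le. Qed.

Lemma presented_generated : generates presented_gen.
Proof.
move=> y; have [s sy] := closure_range_cvgn (csub_valP y).
apply/closure_cvgnP; exists (term_eval presented_gen \o s) => [n|].
  by exists (s n).
apply/cvgrPdist_lt => e e0; have /cvgrPdist_lt/(_ e e0) := sy.
by apply: filterS => n; rewrite /= -val_term_eval_presented.
Qed.

Section UniversalProperty.
Variables (Z : BanachLattice R) (f : I -> Z).
Hypotheses (class_Z : closure_class C Z) (Ef : satisfies E f).

Lemma term_eval_le_presented_gt0 (c : R) t : 0 < c ->
  (forall i, `|f i| <= c * w i) ->
  `|term_eval f t| <= c * `|term_eval presented_gen t|.
Proof.
move=> c0 fw; apply: (closure_class_norm_le class_Z).
  by rewrite mulr_ge0// ltW.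
move=> H h CH homh h_le.
have cinv_gt0 : 0 < c^-1 by rewrite invr_gt0.
have homch := lattice_hom_comp (lattice_hom_scale H cinv_gt0) homh.
have ch_le i : `|c^-1 *: h (f i)| <= w i.
  by rewrite normrZ gtr0_norm// ler_pdivrMl//; exact: le_trans (h_le _) (fw i).
have := term_eval_model_le (Model CH (satisfies_comp homch Ef) ch_le) t.
rewrite -val_term_eval_presented /= (term_eval_comp _ _ homch) /=.
by rewrite normrZ gtr0_norm// ler_pdivrMl.
Qed.

(* The case c < 0, where the hypothesis forces w = 0, makes the operator norm
   bound of [presented_universal] hold for every real c. *)
Lemma term_eval_le_presented (c : R) t :
  (forall i, 0 <= w i) -> (forall i, `|f i| <= c * w i) ->
  `|term_eval f t| <= c * `|term_eval presented_gen t|.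
Proof.
move=> w0 fw; have [c0|c0] := ltP 0 c; first exact: term_eval_le_presented_gt0.
have f0 i : f i = 0.
  by apply/eqP; rewrite -normr_le0 (le_trans (fw i))// mulr_le0_ge0.
rewrite (term_eval_eq0 _ f0) normr0.
move: c0; rewrite le_eqVlt => /predU1P[->|c0]; first by rewrite mul0r.
rewrite term_eval_eq0 ?normr0 ?mulr0// => i.
apply/eqP; rewrite -normr_le0; apply: le_trans (presented_gen_norm (w0 i)) _.
by have := fw i; rewrite f0 normr0 nmulr_rge0.
Qed.

Lemma presented_universal : (forall i, 0 <= w i) ->
  (exists c : R, forall i, `|f i| <= c * w i) ->
  exists gamma : presented -> Z,
    [/\ lattice_hom gamma, gamma \o presented_gen = f &
        forall c : R, (forall i, `|f i| <= c * w i) -> opnorm_le gamma c].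
Proof.
move=> w0 [k fk].
have [gamma [hom_gamma gamma_gen gamma_le]] :=
  lattice_hom_extension presented_generated
    (fun t => term_eval_le_presented t w0 fk).
exists gamma; split=> // c fc.
by apply: gamma_le => t; exact: term_eval_le_presented.
Qed.

End UniversalProperty.

End Presentation.

(** * The pushout *)

Definition copair (A B D : Type) (f : A -> D) (g : B -> D) (i : A + B) : D :=
  match i with inl x => f x | inr y => g y end.

Lemma sum_funext (A B D : Type) (h k : A + B -> D) :
  h \o inl = k \o inl -> h \o inr = k \o inr -> h = k.
Proof.
move=> eql eqr; apply/funext => -[x|y].
  exact: (congr1 (@^~ x) eql).
exact: (congr1 (@^~ y) eqr).
Qed.

Inductive hom_rel (R : realType) (X : BanachLattice R) (I : Type)
    (iota : X -> I) : term_relation R I :=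
  | hom_rel_lin (a : R) (x y : X) : hom_rel iota
      (Var (iota (a *: x + y))) (Lin a (Var (iota x)) (Var (iota y)))
  | hom_rel_join (x y : X) : hom_rel iota
      (Var (iota (BL_join x y))) (Join (Var (iota x)) (Var (iota y))).

Lemma hom_relP (R : realType) (X Z : BanachLattice R) (I : Type)
    (iota : X -> I) (f : I -> Z) :
  satisfies (hom_rel iota) f <-> lattice_hom (f \o iota).
Proof.
split=> [sat|homf _ _ [a x y|x y]] /=.
- split=> [a x y|x y]; first exact: (sat _ _ (hom_rel_lin iota a x y)).
  exact: (sat _ _ (hom_rel_join iota x y)).
- exact: (lattice_homP homf).
- exact: (lattice_hom_join homf).
Qed.

Section CoconeRelations.
Variables (R : realType) (X0 X1 X2 : BanachLattice R).
Variables (T1 : X0 -> X1) (T2 : X0 -> X2).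

Inductive cocone_rel : term_relation R (X1 + X2) :=
  | cocone_rel_inl s t : hom_rel inl s t -> cocone_rel s t
  | cocone_rel_inr s t : hom_rel inr s t -> cocone_rel s t
  | cocone_rel_glue x : cocone_rel (Var (inl (T1 x))) (Var (inr (T2 x))).

Lemma cocone_relP (Z : BanachLattice R) (f : X1 + X2 -> Z) :
  satisfies cocone_rel f <->
  [/\ lattice_hom (f \o inl), lattice_hom (f \o inr) &
      (f \o inl) \o T1 = (f \o inr) \o T2].
Proof.
split=> [sat|[/hom_relP hom1 /hom_relP hom2 glue] _ _ [s t|s t|x]].
- split; last by apply/funext => x; exact: (sat _ _ (cocone_rel_glue x)).
    by apply/hom_relP => s t st; exact: (sat _ _ (cocone_rel_inl st)).
  by apply/hom_relP => s t st; exact: (sat _ _ (cocone_rel_inr st)).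
- exact: hom1.
- exact: hom2.
- exact: (congr1 (@^~ x) glue).
Qed.

End CoconeRelations.

Section Pushout.
Variables (R : realType) (C : BLclass R) (X0 X1 X2 : BanachLattice R).
Variables (T1 : X0 -> X1) (T2 : X0 -> X2).

Definition pushout_weight : X1 + X2 -> R :=
  copair (fun x => `|x|) (fun y => `|y|).

Lemma pushout_weight_ge0 i : 0 <= pushout_weight i.
Proof. by case: i => x /=. Qed.

Definition pushout : BanachLattice R :=
  presented C pushout_weight (cocone_rel T1 T2).

Definition pushout_gen : X1 + X2 -> pushout := presented_gen C _ _.

Definition pushout_inl : X1 -> pushout := pushout_gen \o inl.
Definition pushout_inr : X2 -> pushout := pushout_gen \o inr.

Lemma pushout_cocone : [/\ lattice_hom pushout_inl, lattice_hom pushout_inr &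
  pushout_inl \o T1 = pushout_inr \o T2].
Proof. exact/cocone_relP/presented_gen_satisfies. Qed.

Lemma opnorm_le_pushout_inl : opnorm_le pushout_inl 1.
Proof.
move=> x; rewrite mul1r.
exact: presented_gen_norm (pushout_weight_ge0 (inl x)).
Qed.

Lemma opnorm_le_pushout_inr : opnorm_le pushout_inr 1.
Proof.
move=> y; rewrite mul1r.
exact: presented_gen_norm (pushout_weight_ge0 (inr y)).
Qed.

Lemma pushout_unique (Z : BanachLattice R) (g h : pushout -> Z) :
  lattice_hom g -> lattice_hom h ->
  g \o pushout_inl = h \o pushout_inl -> g \o pushout_inr = h \o pushout_inr ->
  g = h.
Proof.
move=> homg homh eql eqr; apply: lattice_hom_eq_generators homg homh _.
  exact: presented_generated.
exact: sum_funext.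
Qed.

Lemma norm_copair_le (Z : BanachLattice R) (R1 : X1 -> Z) (R2 : X2 -> Z)
    (c : R) :
  opnorm_le R1 c -> opnorm_le R2 c ->
  forall i, `|copair R1 R2 i| <= c * pushout_weight i.
Proof. by move=> R1c R2c [x|y]; [exact: R1c|exact: R2c]. Qed.

Lemma copair_bounded (Z : BanachLattice R) (R1 : X1 -> Z) (R2 : X2 -> Z) :
  bounded_op R1 -> bounded_op R2 ->
  exists c : R, forall i, `|copair R1 R2 i| <= c * pushout_weight i.
Proof.
move=> [c R1c] [d R2d]; exists (Num.max c d); apply: norm_copair_le => x.
  by apply: le_trans (R1c x) _; rewrite ler_wpM2r// le_max lexx.
by apply: le_trans (R2d x) _; rewrite ler_wpM2r// le_max lexx orbT.
Qed.

Lemma pushout_universal (Z : BanachLattice R) (R1 : X1 -> Z) (R2 : X2 -> Z) :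
  closure_class C Z -> lattice_hom R1 -> lattice_hom R2 ->
  R1 \o T1 = R2 \o T2 ->
  exists gamma : pushout -> Z,
    [/\ lattice_hom gamma,
        gamma \o pushout_inl = R1, gamma \o pushout_inr = R2 &
        forall c : R, opnorm_le R1 c -> opnorm_le R2 c -> opnorm_le gamma c].
Proof.
move=> class_Z hom1 hom2 glue.
have rel_R : satisfies (cocone_rel T1 T2) (copair R1 R2) by exact/cocone_relP.
have [gamma [hom_gamma gamma_gen gamma_le]] :=
  presented_universal class_Z rel_R pushout_weight_ge0
    (copair_bounded (lattice_hom_bounded hom1) (lattice_hom_bounded hom2)).
exists gamma; split=> // [||c R1c R2c].
- by rewrite compA gamma_gen.
- by rewrite compA gamma_gen.
- exact/gamma_le/norm_copair_le.
Qed.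

End Pushout.

Theorem mainTheorem15 (R : realType) (C : BLclass R)
  (C_nonempty : exists X : BanachLattice R, C X)
  (C_quot : closed_under_quotients (closure_class C))
  (X0 X1 X2 : BanachLattice R)
  (hX0 : closure_class C X0) (hX1 : closure_class C X1) (hX2 : closure_class C X2)
  (T1 : X0 -> X1) (T2 : X0 -> X2)
  (hT1 : lattice_hom T1) (hT1b : bounded_op T1)
  (hT2 : lattice_hom T2) (hT2b : bounded_op T2) :
  exists (PO : BanachLattice R) (S1 : X1 -> PO) (S2 : X2 -> PO),
    [/\ closure_class C PO,
        lattice_hom S1 /\ lattice_hom S2,
        opnorm_le S1 1 /\ opnorm_le S2 1,
        S1 \o T1 = S2 \o T2 &
        forall (Z : BanachLattice R) (R1 : X1 -> Z) (R2 : X2 -> Z),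
          closure_class C Z -> lattice_hom R1 -> lattice_hom R2 ->
          R1 \o T1 = R2 \o T2 ->
          exists gamma : PO -> Z,
            [/\ lattice_hom gamma, gamma \o S1 = R1, gamma \o S2 = R2,
                (forall c : R, opnorm_le R1 c -> opnorm_le R2 c -> opnorm_le gamma c) &
                (forall gamma' : PO -> Z, lattice_hom gamma' ->
                   gamma' \o S1 = R1 -> gamma' \o S2 = R2 -> gamma' = gamma)]].
Proof.
have [homS1 homS2 glueS] := pushout_cocone C T1 T2.
exists (pushout C T1 T2), (pushout_inl C T1 T2), (pushout_inr C T1 T2).
split=> //; first exact: closure_class_presented.
  by split; [exact: opnorm_le_pushout_inl|exact: opnorm_le_pushout_inr].
move=> Z R1 R2 class_Z homR1 homR2 glueR.
have [gamma [hom_gamma gamma1 gamma2 gamma_le]] :=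
  pushout_universal class_Z homR1 homR2 glueR.
exists gamma; split=> // gamma' hom_gamma' gamma'1 gamma'2.
by apply: pushout_unique => //; rewrite ?gamma1 ?gamma2.
Qed.
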